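(* Let $V$ be the $9$-dimensional $\mathbb F_3$-vector space with basis $e_1,\ldots,e_9$ and let $q:V\to\Lambda^2V$ be the linear map given explicitly in the context. Set \[ \Gamma(q)=\{g\in\operatorname{GL}(V): q\circ g=(\Lambda^2g)\circ q\} \] and \[ \Gamma_{\mathrm{sim}}(q)=\{g\in\operatorname{GL}(V): q\circ g=\lambda(\Lambda^2g)\circ q\ \text{for some }\lambda\in\mathbb F_3^\times\}. \] Then $\Gamma(q)=\{I\}$ and $\Gamma_{\mathrm{sim}}(q)=\{I,-I\}$. Consequently the induced action of $\Gamma_{\mathrm{sim}}(q)$ on the projective space $\operatorname{PG}(V)=\operatorname{PG}(8,3)$ of one-dimensional subspaces of $V$ is trivial.
   Context: For a linear map $g:V\to V$, $\Lambda^2g:\Lambda^2V\to\Lambda^2V$ is the induced map $u\wedge w\mapsto gu\wedge gw$; $I$ is the identity of $V$. The linear map $q:V\to\Lambda^2V$ is defined on the basis by \begin{align*} q(e_1)&=e_2\wedge e_3+e_4\wedge e_5+e_6\wedge e_7+e_8\wedge e_9,\\ q(e_2)&=e_1\wedge e_3+e_4\wedge e_6+e_5\wedge e_8+e_7\wedge e_9,\\ q(e_3)&=e_1\wedge e_2+e_4\wedge e_7+e_5\wedge e_9+e_6\wedge e_8,\\ q(e_4)&=e_1\wedge e_5+e_2\wedge e_6+e_3\wedge e_9+e_7\wedge e_8,\\ q(e_5)&=e_1\wedge e_4+e_2\wedge e_8+e_3\wedge e_7+e_6\wedge e_9,\\ q(e_6)&=e_1\wedge e_7+e_2\wedge e_9+e_3\wedge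 e_5+e_4\wedge e_8,\\ q(e_7)&=e_1\wedge e_8+e_4\wedge e_9+e_3\wedge e_6+e_2\wedge e_5,\\ q(e_8)&=e_1\wedge e_9+e_3\wedge e_4+e_2\wedge e_7+e_5\wedge e_6,\\ q(e_9)&=e_1\wedge e_6+e_3\wedge e_8+e_2\wedge e_4+e_5\wedge e_7. \end{align*} *)

(* Defs.v *)
From HB Require Import structures.
From mathcomp Require Import all_boot all_order all_algebra.

Set Implicit Arguments.
Unset Strict Implicit.
Unset Printing Implicit Defensive.

Import GRing.Theory.
Local Open Scope ring_scope.

Section ExteriorSquare.
Variables (F : fieldType) (n : nat).
Implicit Types (u v w : 'rV[F]_n) (g : 'End('rV[F]_n)).

Definition ltpair := {p : 'I_n * 'I_n | p.1 < p.2}%N.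

(* The exterior square of F^n, in coordinates on the basis e_i /\ e_j, i < j.
   Lemma [ext2_universal] below is its universal property. *)
Definition ext2 : vectType F := {ffun ltpair -> F^o}.

Definition wedge u w : ext2 :=
  [ffun p : ltpair =>
     u 0 (val p).1 * w 0 (val p).2 - u 0 (val p).2 * w 0 (val p).1 : F^o].

Definition ebasis (i : 'I_n) : 'rV[F]_n := delta_mx 0 i.

Definition ext2_lift (W : vectType F) (b : 'rV[F]_n -> 'rV[F]_n -> W)
    (x : ext2) : W :=
  \sum_(p : ltpair) (x p : F) *: b (ebasis (val p).1) (ebasis (val p).2).

(* Lambda^2 g is the linear map induced by (u, w) |-> g u /\ g w. *)
Definition ext2_map g : 'End(ext2) :=
  linfun (ext2_lift (fun u w => wedge (g u) (g w))).

Fact ext2_lift_is_linear (W : vectType F) b : linear (@ext2_lift W b).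
Proof.
move=> a x y; rewrite /ext2_lift scaler_sumr -big_split /=.
by apply: eq_bigr => p _; rewrite !ffunE scalerDl scalerA.
Qed.
HB.instance Definition _ (W : vectType F) b :=
  GRing.isLinear.Build F ext2 W _ (@ext2_lift W b) (@ext2_lift_is_linear W b).

Lemma wedge_linearl w : linear (wedge^~ w).
Proof.
move=> a u v; apply/ffunP=> p; rewrite !ffunE !mxE /= !mulrDl !opprD.
by rewrite /GRing.scale /= mulrBr !mulrA addrACA.
Qed.

Lemma wedge_linearr u : linear (wedge u).
Proof.
move=> a v w; apply/ffunP=> p; rewrite !ffunE !mxE /= !mulrDr !opprD.
by rewrite /GRing.scale /= mulrBr addrACA !(mulrCA _ a).
Qed.

Lemma wedge_alt u : wedge u u = 0.
Proof. by apply/ffunP=> p; rewrite !ffunE mulrC subrr. Qed.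

Lemma wedge_ebasis (p q : ltpair) :
  wedge (ebasis (val p).1) (ebasis (val p).2) q = (p == q)%:R.
Proof.
case: p q => -[i j] /= ij [[k l] /= kl]; rewrite !ffunE !mxE /=.
rewrite -[RHS]/(((i, j) == (k, l))%:R) xpair_eqE (eq_sym i) (eq_sym j) -!natrM !mulnb.
suff -> : (l == i) && (k == j) = false by rewrite subr0.
by apply/negP=> /andP[/eqP li /eqP kj]; subst; have := ltn_trans ij kl; rewrite ltnn.
Qed.

Lemma ext2_decomp (x : ext2) :
  x = \sum_(p : ltpair) (x p : F) *:
        wedge (ebasis (val p).1) (ebasis (val p).2).
Proof.
apply/ffunP=> q; rewrite sum_ffunE (bigD1 q) //= big1 => [|p neq_pq].
  by rewrite ffunE wedge_ebasis eqxx addr0 /GRing.scale /= mulr1.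
by rewrite ffunE wedge_ebasis (negPf neq_pq) scaler0.
Qed.

Section Universal.
Variables (W : vectType F) (b : 'rV[F]_n -> 'rV[F]_n -> W).
Hypotheses (bl : forall w, linear (b^~ w)) (br : forall u, linear (b u)).
Hypothesis balt : forall u, b u u = 0.

Lemma ext2_lift_wedge u w : ext2_lift b (wedge u w) = b u w.
Proof.
have bDl u1 u2 v : b (u1 + u2) v = b u1 v + b u2 v.
  by have := bl v 1 u1 u2; rewrite /= !scale1r.
have bDr u1 u2 v : b v (u1 + u2) = b v u1 + b v u2.
  by have := br v 1 u1 u2; rewrite /= !scale1r.
have b0l v : b 0 v = 0 by apply: (addrI (b 0 v)); rewrite -bDl !addr0.
have b0r v : b v 0 = 0 by apply: (addrI (b v 0)); rewrite -bDr !addr0.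
have bZl a u1 v : b (a *: u1) v = a *: b u1 v.
  by have := bl v a u1 0; rewrite /= b0l !addr0.
have bZr a u1 v : b v (a *: u1) = a *: b v u1.
  by have := br v a u1 0; rewrite /= b0r !addr0.
have bN u1 u2 : b u1 u2 = - b u2 u1.
  apply/eqP; rewrite -addr_eq0; have := balt (u1 + u2).
  by rewrite bDl !bDr !balt add0r addr0 => ->.
have -> : b u w = \sum_(p : 'I_n * 'I_n)
    (u 0 p.1 * w 0 p.2) *: b (ebasis p.1) (ebasis p.2).
  rewrite {1}(row_sum_delta u) (big_morph (b^~ w) (id1 := 0) (op1 := +%R)) //.
  rewrite -(pair_bigA _ (fun i j => (u 0 i * w 0 j) *: b (ebasis i) (ebasis j))).
  apply: eq_bigr => i _; rewrite /= bZl {1}(row_sum_delta w).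
  rewrite (big_morph (b _) (id1 := 0) (op1 := +%R)) // scaler_sumr.
  by apply: eq_bigr => j _; rewrite bZr scalerA.
rewrite (bigID (fun p : 'I_n * 'I_n => p.1 < p.2)%N) /=.
rewrite [X in _ + X](bigID (fun p : 'I_n * 'I_n => p.1 == p.2)) /=.
rewrite [X in _ + (X + _)]big1 ?add0r => [|p /andP[_ /eqP->]]; last first.
  by rewrite balt scaler0.
rewrite [X in _ + X](reindex_inj (h := fun p : 'I_n * 'I_n => (p.2, p.1))) /=; last first.
  by move=> [i j] [k l] [-> ->].
rewrite [X in _ + X](eq_bigl (fun p : 'I_n * 'I_n => p.1 < p.2)%N); last first.
  by move=> [i j] /=; rewrite -leqNgt ltn_neqAle andbC eq_sym.
rewrite -big_split /= /ext2_lift.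
rewrite [RHS](reindex_omap (val : ltpair -> _) insub) /=; last first.
  by move=> p ?; rewrite insubT.
apply: eq_big => [[p ltp]|[p ltp] _] /=; first by rewrite ltp insubT eqxx.
by rewrite ffunE /= [b (ebasis p.2) _]bN scalerN -scalerBl.
Qed.

Lemma ext2_universal :
  (forall u w, ext2_lift b (wedge u w) = b u w) /\
  (forall f : {linear ext2 -> W},
     (forall u w, f (wedge u w) = b u w) -> f =1 ext2_lift b).
Proof.
split=> [|f fE x]; first exact: ext2_lift_wedge.
rewrite [in LHS](ext2_decomp x) linear_sum; apply: eq_bigr => p _.
by rewrite linearZ fE.
Qed.

End Universal.

Lemma ext2_map_wedge g u w : ext2_map g (wedge u w) = wedge (g u) (g w).
Proof.
rewrite /ext2_map lfunE; apply: ext2_lift_wedge => v; last exact: wedge_alt.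
  by move=> a x y /=; rewrite linearP wedge_linearl.
by move=> a x y; rewrite linearP wedge_linearr.
Qed.

(* In finite dimension an endomorphism is invertible iff it is injective. *)
Definition GL : {pred 'End('rV[F]_n)} := fun g => lker g == 0%VS.

Definition Gamma (q : 'Hom('rV[F]_n, ext2)) : {pred 'End('rV[F]_n)} :=
  fun g => (g \in GL) && ((q \o g)%VF == (ext2_map g \o q)%VF).

End ExteriorSquare.

Definition Gamma_sim (F : finFieldType) (n : nat) (q : 'Hom('rV[F]_n, ext2 F n)) :
    {pred 'End('rV[F]_n)} :=
  fun g => (g \in @GL F n) &&
    [exists l : F, (l != 0) && ((q \o g)%VF == l *: (ext2_map g \o q)%VF)].

Local Notation V := 'rV['F_3]_9.

(* 1-based indexing of the basis vectors; only used for 1 <= k <= 9. *)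
Definition e (k : nat) : V := ebasis 'F_3 (inord k.-1).

Local Notation "u /\_ w" := (wedge u w) (at level 45).

Definition q_basis : seq (ext2 'F_3 9) :=
  [:: e 2 /\_ e 3 + e 4 /\_ e 5 + e 6 /\_ e 7 + e 8 /\_ e 9;
      e 1 /\_ e 3 + e 4 /\_ e 6 + e 5 /\_ e 8 + e 7 /\_ e 9;
      e 1 /\_ e 2 + e 4 /\_ e 7 + e 5 /\_ e 9 + e 6 /\_ e 8;
      e 1 /\_ e 5 + e 2 /\_ e 6 + e 3 /\_ e 9 + e 7 /\_ e 8;
      e 1 /\_ e 4 + e 2 /\_ e 8 + e 3 /\_ e 7 + e 6 /\_ e 9;
      e 1 /\_ e 7 + e 2 /\_ e 9 + e 3 /\_ e 5 + e 4 /\_ e 8;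
      e 1 /\_ e 8 + e 4 /\_ e 9 + e 3 /\_ e 6 + e 2 /\_ e 5;
      e 1 /\_ e 9 + e 3 /\_ e 4 + e 2 /\_ e 7 + e 5 /\_ e 6;
      e 1 /\_ e 6 + e 3 /\_ e 8 + e 2 /\_ e 4 + e 5 /\_ e 7].

Definition q_fun (v : V) : ext2 'F_3 9 :=
  \sum_(i < 9) v 0 i *: q_basis`_i.

Definition q : 'Hom(V, ext2 'F_3 9) := linfun q_fun.

Fact q_fun_is_linear : linear q_fun.
Proof.
move=> a u v; rewrite /q_fun scaler_sumr -big_split /=.
by apply: eq_bigr => i _; rewrite !mxE scalerDl scalerA.
Qed.
HB.instance Definition _ :=
  GRing.isLinear.Build 'F_3 V (ext2 'F_3 9) _ q_fun q_fun_is_linear.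

Lemma qE k : (0 < k <= 9)%N -> q (e k) = q_basis`_k.-1.
Proof.
case: k => // k /= ltk; rewrite lfunE /= /q_fun (bigD1 (inord k)) //= big1.
  by rewrite addr0 /e /ebasis mxE !eqxx scale1r inordK.
by move=> i /negPf neq_ik; rewrite /e /ebasis mxE eqxx /= neq_ik scale0r.
Qed.

(* Main.v *)
From HB Require Import structures.
Require Import Defs.
From mathcomp Require Import all_boot all_order all_algebra.

Set Implicit Arguments.
Unset Strict Implicit.
Unset Printing Implicit Defensive.

Import GRing.Theory.
Local Open Scope ring_scope.

(** Dually, [q] is a bilinear alternating product on [V^*], and a member [g] of
    [Gamma q] is an automorphism of that algebra. Write [S v] for the
    alternating matrix of [q v], [G] for the matrix of [g] acting on row
    vectors, and [ad x] for the operator [v |-> x *m S v] on [V], where [x] is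
    a row of coordinates of an element of [V^*]. Everything that can be built
    naturally from [S] is respected by [G]; the proof builds enough natural
    objects to leave no freedom.

    - The Killing form [tr (ad x * ad z)] has rank 8, so [G] can only rescale
      a generator [r] of its radical, by some [eps = 1] or [-1]. Hence [G]
      commutes with [D = ad r] up to [eps], and with [D^2] exactly.
    - The linear form [f : x |-> tr (D^2 * ad x)] is therefore a fixed vector
      of [V], and [h = f D^3] is fixed up to sign.
    - The alternating form [S h] also has rank 8, so [G] can only rescale a
      generator [y] of its radical; since [f] is fixed and [f(y)] is nonzero,
      [y] is fixed. Hence [G] commutes with [N = ad y].
    - The vectors [f, f N, ..., f N^8] are all fixed, and they form a basis
      of [V]. So [G = 1].

    The argument is [tensor_rigid]; [skewq_rigid] supplies the numerical facts
    for the given [q], which are identities between matrices over [F_3]. For a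
    similarity, replacing [g] by [-g] does not change [Lambda^2 g] but changes
    the sign of [lambda], and [F_3^* = {1, -1}]. *)

(** * Bivectors as alternating matrices *)

Section Skew.
Variables (F : fieldType) (n : nat).
Implicit Types (u v w : 'rV[F]_n) (g : 'End('rV[F]_n)).

Definition skew : ext2 F n -> 'M[F]_n :=
  ext2_lift (fun u w => u^T *m w - w^T *m u).
HB.instance Definition _ := GRing.Linear.on skew.

Lemma skew_wedge u w : skew (wedge u w) = u^T *m w - w^T *m u.
Proof.
apply: (@ext2_lift_wedge F n ('M[F]_n)) => [v a x y|v a x y|v] /=.
- rewrite [(_ + _)^T]linearP mulmxDl mulmxDr -scalemxAl -scalemxAr.
  by rewrite scalerBr opprD addrACA.
- rewrite [(_ + _)^T]linearP mulmxDl mulmxDr -scalemxAl -scalemxAr.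
  by rewrite scalerBr opprD addrACA.
- by rewrite subrr.
Qed.

Lemma skew_wedgeE u w i j :
  skew (wedge u w) i j = u 0 i * w 0 j - w 0 i * u 0 j.
Proof. by rewrite skew_wedge !mxE !big_ord1 !mxE. Qed.

(** [u /\ w] goes to [u^T w - w^T u], and replacing [u], [w] by [u G], [w G]
    multiplies this by [G^T] and [G] on the two sides. *)
Lemma skew_ext2_map g (x : ext2 F n) :
  skew (ext2_map g x) = (lin1_mx g)^T *m skew x *m lin1_mx g.
Proof.
rewrite (ext2_decomp x); elim/big_rec: _ => [|p y _ IHy].
  by rewrite [ext2_map g 0]linear0 [skew 0]linear0 mulmx0 mul0mx.
rewrite [ext2_map g (_ + _)]linearP ![skew (_ + _)]linearP /=.
rewrite IHy mulmxDr mulmxDl -scalemxAr -scalemxAl ext2_map_wedge.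
rewrite !skew_wedge -!(mul_rV_lin1 g) !trmx_mul.
by rewrite mulmxBr mulmxBl !mulmxA.
Qed.
End Skew.

Lemma ext2_hom_ext (F : fieldType) n (W : vectType F)
    (f1 f2 : 'Hom(ext2 F n, W)) :
  (forall u w, f1 (wedge u w) = f2 (wedge u w)) -> f1 = f2.
Proof.
move=> f12; apply/lfunP=> x; rewrite (ext2_decomp x).
elim/big_rec: _ => [|p z _ IHz]; first by rewrite [LHS]linear0 [RHS]linear0.
by rewrite [LHS]linearP [RHS]linearP /= IHz f12.
Qed.

Lemma ext2_map1 (F : fieldType) n : ext2_map \1%VF = \1%VF :> 'End(ext2 F n).
Proof.
by apply: ext2_hom_ext => u w; rewrite ext2_map_wedge !id_lfunE.
Qed.

Lemma ext2_mapN (F : fieldType) n (g : 'End('rV[F]_n)) :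
  ext2_map (- g) = ext2_map g.
Proof.
apply: ext2_hom_ext => u w; rewrite !ext2_map_wedge !opp_lfunE.
by apply/ffunP=> i; rewrite !ffunE !mxE !mulrNN.
Qed.

(** * The algebra dual to a linear family of forms, and its symmetries *)

Section Tensor.
Variables (F : fieldType) (n : nat) (S : {linear 'rV[F]_n -> 'M[F]_n}).
Implicit Types (v x : 'rV[F]_n) (A G : 'M[F]_n).

(** [S v] is a bilinear form on [V^*], for [v] in [V]; so [S] encodes a product
    on [V^*], and [ad x], acting on [V] from the right, is the transpose of
    multiplication by [x]. *)
Definition ad x : 'M[F]_n := lin1_mx (mulmx x \o S).

Lemma mul_ad v x : v *m ad x = x *m S v.
Proof. by rewrite mul_rV_lin1. Qed.

Fact ad_is_linear : linear ad.
Proof.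
move=> a x y; apply/row_matrixP=> i.
by rewrite linearP /= !rowE !mul_ad mulmxDl scalemxAl.
Qed.
HB.instance Definition _ := GRing.isLinear.Build F _ _ _ ad ad_is_linear.

(** The row vector representing the linear form [x |-> tr (A * ad x)] on
    [V^*], hence an element of [V]. *)
Definition trace_form A : 'rV[F]_n := \row_i \tr (A *m ad (delta_mx 0 i)).

Lemma trace_formE A x : trace_form A *m x^T = (\tr (A *m ad x))%:M.
Proof.
rewrite [LHS]mx11_scalar [in RHS](row_sum_delta x) !linear_sum mxE.
congr (_%:M); apply: eq_bigr => i _ /=.
by rewrite !mxE [ad (_ *: _)]linearZ -scalemxAr mxtraceZ mulrC.
Qed.

Definition killing : 'M[F]_n := \matrix_i trace_form (ad (delta_mx 0 i)).

Lemma mul_killing x : x *m killing = trace_form (ad x).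
Proof.
apply/rowP=> j; rewrite !mxE [in RHS](row_sum_delta x) linear_sum mulmx_suml.
rewrite linear_sum /=; apply: eq_bigr => i _.
by rewrite !mxE [ad (_ *: _)]linearZ -scalemxAl mxtraceZ.
Qed.

Section Symmetry.
Variable G : 'M[F]_n.
Hypotheses (G_unit : G \in unitmx).
Hypothesis G_sym : forall v, S (v *m G) = G^T *m S v *m G.

(** [G] acts on [V] by [v |-> v G]; its action on [V^*] compatible with the
    product is [x |-> x G^T]. *)
Lemma ad_sym x : G *m ad x = ad (x *m G^T) *m G.
Proof.
apply/row_matrixP=> i; rewrite !rowE !mulmxA mul_ad mul_ad.
by rewrite G_sym !mulmxA.
Qed.

(** Traces are invariant under conjugation by [G]. Taking [A = B] shows that
    the trace form of an operator commuting with [G] is a fixed vector; taking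
    [A = ad x] and [B = ad (x G^T)] gives the invariance of the Killing
    form. *)
Lemma trace_form_sym A B : B *m G = G *m A -> trace_form B *m G = trace_form A.
Proof.
move=> BG; apply/rowP=> i.
have entry (u : 'rV[F]_n) : u 0 i = (u *m (delta_mx 0 i : 'rV_n)^T) 0 0.
  by rewrite trmx_delta -colE mxE.
have GT (u : 'rV[F]_n) : G *m u^T = (u *m G^T)^T by rewrite trmx_mul trmxK.
rewrite !entry -mulmxA GT !trace_formE !mxE eqxx.
rewrite -(mulmxK G_unit (ad (_ *m _))) -ad_sym !mulmxA BG.
by rewrite -!mulmxA mxtrace_mulC -!mulmxA mulVmx // mulmx1.
Qed.

Lemma killing_sym : G^T *m killing *m G = killing.
Proof.
apply/row_matrixP=> i; rewrite !rowE !mulmxA !mul_killing.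
by apply: trace_form_sym; rewrite ad_sym.
Qed.

Lemma form_kernel_sym c (M : 'M[F]_n) x :
  G^T *m M *m G = c *: M -> x *m M = 0 -> x *m G^T *m M = 0.
Proof.
move=> GM xM; rewrite -[LHS](mulmxK G_unit) -!mulmxA (mulmxA G^T) (mulmxA _ G).
by rewrite GM -scalemxAl -scalemxAr mulmxA xM mul0mx scaler0.
Qed.
End Symmetry.
End Tensor.

(** A right inverse of [M] up to the rank-one matrix [w r] certifies that [M]
    has corank at most one. *)
Lemma kernel_line (F : fieldType) m n (M : 'M[F]_(m, n)) L w (r x : 'rV_m) :
  M *m L = 1%:M - w *m r -> x *m M = 0 -> exists c, x = c *: r.
Proof.
move=> ML xM; exists ((x *m w) 0 0); rewrite -mul_scalar_mx -mx11_scalar.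
apply/eqP; rewrite -subr_eq0 -mulmxA -[X in X - _]mulmx1 -mulmxBr -ML.
by rewrite mulmxA xM mul0mx.
Qed.

(** * Matrices over F_3 as tables of residues *)

(** Naturals stand for their classes mod 3. Each operation on tables reduces
    its entries, so that equal matrices obtained as results of operations are
    equal tables and identities between them can be evaluated. *)
Definition table := seq (seq nat).
Definition entry (A : table) i j := nth 0 (nth [::] A i) j.
Definition tabulate m n (f : nat -> nat -> nat) : table :=
  mkseq (fun i => mkseq (fun j => f i j %% 3)%N n) m.
Definition sum_upto n (f : nat -> nat) := sumn [seq f i | i <- iota 0 n].
Definition mx m n (A : table) : 'M['F_3]_(m, n) :=
  \matrix_(i, j) (entry A i j)%:R.

Lemma natr_mod3 k : (k %% 3)%N%:R = k%:R :> 'F_3.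
Proof. exact: Fp_nat_mod. Qed.

Lemma natr_sum_upto n f :
  (sum_upto n f)%:R = \sum_(i < n) (f i)%:R :> 'F_3.
Proof.
rewrite /sum_upto sumnE big_map natr_sum.
rewrite -(big_mkord xpredT (fun i => (f i)%:R)).
by rewrite /index_iota subn0.
Qed.

Lemma mx_tabulate m n f (i : 'I_m) (j : 'I_n) :
  mx m n (tabulate m n f) i j = (f i j)%:R.
Proof. by rewrite mxE /entry !nth_mkseq // natr_mod3. Qed.

Definition mul_table m n p A B : table :=
  tabulate m p (fun i j => sum_upto n (fun k => entry A i k * entry B k j)%N).

Lemma mx_mul m n p A B :
  mx m p (mul_table m n p A B) = mx m n A *m mx n p B.
Proof.
apply/matrixP=> i j; rewrite mx_tabulate natr_sum_upto mxE.
by apply: eq_bigr => k _; rewrite !mxE natrM.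
Qed.

Definition trace_mul A B :=
  sum_upto 9 (fun i => sum_upto 9 (fun j => entry A i j * entry B j i)%N).

Lemma natr_trace_mul A B : (trace_mul A B)%:R = \tr (mx 9 9 A *m mx 9 9 B).
Proof.
rewrite natr_sum_upto; apply: eq_bigr => i _; rewrite mxE natr_sum_upto.
by apply: eq_bigr => j _; rewrite !mxE natrM.
Qed.

Definition unit_row i : table := tabulate 1 9 (fun _ j => (i == j)%N).

Lemma mx_unit_row (i : 'I_9) : mx 1 9 (unit_row i) = delta_mx 0 i.
Proof. by apply/rowP=> j; rewrite mx_tabulate !mxE eqxx eq_sym. Qed.

Definition id_table : table := tabulate 9 9 (fun i j => (i == j)%N).

Lemma mx_id : mx 9 9 id_table = 1%:M.
Proof. by apply/matrixP=> i j; rewrite mx_tabulate !mxE. Qed.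

(** * The given map q in tables *)

(** The pair [(a, b)] stands for the term [e_a /\ e_b]; all the coefficients of
    [q] are 1. *)
Definition wedge_pairs : seq (seq (nat * nat)) :=
  [:: [:: (2, 3); (4, 5); (6, 7); (8, 9)];
      [:: (1, 3); (4, 6); (5, 8); (7, 9)];
      [:: (1, 2); (4, 7); (5, 9); (6, 8)];
      [:: (1, 5); (2, 6); (3, 9); (7, 8)];
      [:: (1, 4); (2, 8); (3, 7); (6, 9)];
      [:: (1, 7); (2, 9); (3, 5); (4, 8)];
      [:: (1, 8); (4, 9); (3, 6); (2, 5)];
      [:: (1, 9); (3, 4); (2, 7); (5, 6)];
      [:: (1, 6); (3, 8); (2, 4); (5, 7)]]%N.

Definition skewq : {linear 'rV['F_3]_9 -> 'M['F_3]_9} := @skew _ _ \o q.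

(** The entry [(i, j)] of the matrix of [q e_k], counting from 0; the factor 2
    is the coefficient -1 of the alternating matrix. *)
Definition skewq_coef k i j : nat :=
  sumn [seq ((i.+1 == p.1) && (j.+1 == p.2) +
            2 * ((i.+1 == p.2) && (j.+1 == p.1)))%N
       | p <- nth [::] wedge_pairs k].

Lemma skew_wedge_e a b (i j : 'I_9) : (0 < a <= 9)%N -> (0 < b <= 9)%N ->
  skew (wedge (e a) (e b)) i j =
    ((i.+1 == a) && (j.+1 == b) + 2 * ((i.+1 == b) && (j.+1 == a)))%N%:R.
Proof.
have eE c (k : 'I_9) : (0 < c <= 9)%N -> e c 0 k = (k.+1 == c)%:R.
  by case: c => // c ltc; rewrite mxE eqxx -val_eqE /= inordK.
move=> ha hb; rewrite skew_wedgeE !eE // -!natrM !mulnb.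
rewrite natrD natrM; have -> : 2%:R = -1 :> 'F_3 by apply/eqP.
by rewrite mulN1r.
Qed.

Lemma big_seq4 (V : nmodType) (I : Type) (f : I -> V) a b c d :
  \sum_(i <- [:: a; b; c; d]) f i = f a + f b + f c + f d.
Proof. by rewrite !big_cons big_nil addr0 !addrA. Qed.

Lemma skewq_e (k i j : 'I_9) : skewq (delta_mx 0 k) i j = (skewq_coef k i j)%:R.
Proof.
have -> : delta_mx 0 k = e k.+1 by rewrite /e /ebasis /= inord_val.
rewrite /skewq_coef /= qE //=.
have -> : q_basis =
    [seq \sum_(p <- ps) wedge (e p.1) (e p.2) | ps <- wedge_pairs].
  by congr [:: _; _; _; _; _; _; _; _; _]; rewrite big_seq4.
rewrite (nth_map [::]) //.
have : all (fun p : nat * nat => (0 < p.1 <= 9) && (0 < p.2 <= 9))%N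
           (nth [::] wedge_pairs k).
  by case: k => -[|[|[|[|[|[|[|[|[|//]]]]]]]]].
elim: (nth _ _ _) => [|p s IHs] /=; first by rewrite big_nil linear0 mxE.
case/andP=> /andP[hp1 hp2] hs.
by rewrite big_cons linearD mxE IHs // skew_wedge_e // -natrD.
Qed.

Definition skewq_table (v : table) : table :=
  tabulate 9 9
    (fun i j => sum_upto 9 (fun k => entry v 0 k * skewq_coef k i j)%N).

Lemma mx_skewq v : mx 9 9 (skewq_table v) = skewq (mx 1 9 v).
Proof.
apply/matrixP=> i j; rewrite mx_tabulate natr_sum_upto.
rewrite [mx 1 9 v]row_sum_delta linear_sum summxE; apply: eq_bigr => k _.
by rewrite linearZ [RHS]mxE skewq_e natrM mxE.
Qed.

Definition ad_table (x : table) : table :=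
  tabulate 9 9
    (fun k j => sum_upto 9 (fun i => entry x 0 i * skewq_coef k i j)%N).

Lemma mx_ad x : mx 9 9 (ad_table x) = ad skewq (mx 1 9 x).
Proof.
apply/matrixP=> k j; rewrite mx_tabulate natr_sum_upto.
have -> : ad skewq (mx 1 9 x) k j =
    ((delta_mx 0 k : 'rV_9) *m ad skewq (mx 1 9 x)) 0 j.
  by rewrite -rowE [RHS]mxE.
rewrite mul_ad mxE; apply: eq_bigr => i _.
by rewrite skewq_e natrM mxE.
Qed.

Definition trace_form_table A : table :=
  tabulate 1 9 (fun _ j => trace_mul A (ad_table (unit_row j))).

Lemma mx_trace_form A :
  mx 1 9 (trace_form_table A) = trace_form skewq (mx 9 9 A).
Proof.
apply/rowP=> j.
by rewrite mx_tabulate natr_trace_mul mx_ad mx_unit_row [in RHS]mxE.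
Qed.

Definition killing_table : table :=
  tabulate 9 9
    (fun i j => entry (trace_form_table (ad_table (unit_row i))) 0 j).

Lemma mx_killing : mx 9 9 killing_table = killing skewq.
Proof.
apply/matrixP=> i j; rewrite mx_tabulate [RHS]mxE -mx_unit_row -mx_ad.
by rewrite -mx_trace_form [RHS]mxE.
Qed.

(** * Rigidity *)

Definition krylov (F : fieldType) n (N : 'M[F]_n) (f : 'rV[F]_n) : 'M[F]_n :=
  \matrix_(j < n) iter j (mulmxr N) f.

Lemma F3_sqr (c : 'F_3) : c != 0 -> c * c = 1.
Proof. by case: c => -[|[|[|[]]]] // lt3 _; apply/val_inj. Qed.

(** The two radicals are lines, so that [G] acts on each of them by a scalar;
    [f(y) <> 0] determines the second scalar, and the last hypothesis says that
    [f] is a cyclic vector of [ad y]. *)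
Section Rigidity.
Variables (n : nat) (S : {linear 'rV['F_3]_n -> 'M['F_3]_n}).
Variables (r y : 'rV['F_3]_n).

Let D := ad S r.
Let f := trace_form S (D *m D).
Let h := f *m D *m D *m D.

Hypotheses (r_neq0 : r != 0) (rK : r *m killing S = 0).
Hypothesis killing_line : forall x, x *m killing S = 0 -> exists c, x = c *: r.
Hypotheses (fy_neq0 : f *m y^T != 0) (yh : y *m S h = 0).
Hypothesis form_line : forall x, x *m S h = 0 -> exists c, x = c *: y.
Hypothesis krylov_full : row_full (krylov (ad S y) f).

Lemma tensor_rigid G : G \in unitmx ->
  (forall v, S (v *m G) = G^T *m S v *m G) -> G = 1%:M.
Proof.
move=> Gu Gsym; have GTu : G^T \in unitmx by rewrite unitmx_tr.
have [eps rG] : exists eps, r *m G^T = eps *: r.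
  apply: killing_line; apply: (form_kernel_sym Gu (c := 1)) => //.
  by rewrite scale1r; apply: killing_sym.
have eps2 : eps * eps = 1.
  apply/F3_sqr/eqP=> eps0; move/eqP: r_neq0; apply.
  by rewrite -(mulmxK GTu r) rG eps0 scale0r mul0mx.
have DG m (u : 'M_(m, n)) : u *m D *m G = eps *: (u *m G *m D).
  rewrite -!mulmxA (ad_sym Gsym) rG [ad S (_ *: _)]linearZ -scalemxAl.
  by rewrite -scalemxAr scalerA eps2 scale1r.
have fG : f *m G = f.
  apply: (trace_form_sym Gu Gsym); rewrite DG -[D *m G](mul1mx (D *m G)) mulmxA.
  by rewrite DG mul1mx -scalemxAl scalerA eps2 scale1r mulmxA.
have hG : h *m G = eps *: h.
  rewrite /h (DG _ (f *m D *m D)) (DG _ (f *m D)) (DG _ f) fG -!scalemxAl.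
  by rewrite (scalerA eps eps) eps2 scale1r.
have [c yG] : exists c, y *m G^T = c *: y.
  apply/form_line/(form_kernel_sym Gu (c := eps)) => //.
  by rewrite -Gsym hG linearZ.
(* [f(y)] is computed before and after moving both [f] and [y] by [G]. *)
have c1 : c = 1.
  have : f *m y^T = c *: (f *m y^T).
    by rewrite -{1}fG scalemxAr -linearZ /= -yG trmx_mul trmxK mulmxA.
  move/eqP; rewrite -subr_eq0 -{1}[f *m _]scale1r -scalerBl scaler_eq0.
  by rewrite (negPf fy_neq0) orbF subr_eq0 => /eqP.
have NG : ad S y *m G = G *m ad S y by rewrite (ad_sym Gsym) yG c1 scale1r.
have BG : krylov (ad S y) f *m G = krylov (ad S y) f.
  apply/row_matrixP=> j; rewrite row_mul rowK.
  by elim: (j : nat) => //= k IHk; rewrite -mulmxA NG mulmxA IHk.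
have [L LB] := row_fullP krylov_full.
by rewrite -[LHS]mul1mx -LB -mulmxA BG.
Qed.
End Rigidity.

(** * Numerical verification for q *)

(** Generators of the radicals of the Killing form and of [S h]. *)
Definition r_row : table := [:: [:: 1; 2; 2; 0; 1; 1; 1; 1; 2]]%N.
Definition y_row : table := [:: [:: 1; 2; 1; 0; 1; 2; 1; 2; 2]]%N.

(** Inverses of the Killing form and of [S h] up to rank one, as required by
    [kernel_line], and the inverse of the Krylov matrix of [f]; all three come
    from Gaussian elimination. *)
Definition killing_coker : table :=
  [:: [:: 0; 0; 2; 2; 2; 2; 2; 2; 0];
      [:: 0; 2; 1; 1; 2; 1; 0; 2; 0];
      [:: 0; 0; 0; 1; 1; 2; 0; 1; 2];
      [:: 0; 0; 0; 0; 0; 2; 2; 1; 2];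
      [:: 0; 1; 2; 2; 0; 2; 2; 0; 2];
      [:: 0; 0; 0; 1; 2; 2; 2; 1; 2];
      [:: 0; 2; 1; 1; 2; 2; 2; 2; 2];
      [:: 0; 1; 2; 0; 0; 1; 2; 1; 2];
      [:: 0; 0; 0; 0; 0; 0; 0; 0; 0]]%N.
Definition form_coker : table :=
  [:: [:: 0; 0; 1; 2; 0; 0; 1; 2; 0];
      [:: 0; 0; 1; 0; 1; 0; 2; 1; 0];
      [:: 0; 1; 1; 1; 1; 2; 2; 0; 2];
      [:: 0; 1; 1; 0; 0; 1; 0; 0; 1];
      [:: 0; 2; 0; 2; 0; 0; 0; 2; 0];
      [:: 0; 0; 0; 0; 0; 0; 2; 2; 0];
      [:: 0; 0; 0; 2; 1; 0; 1; 1; 2];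
      [:: 0; 0; 1; 1; 0; 2; 0; 1; 1];
      [:: 0; 0; 0; 0; 0; 0; 0; 0; 0]]%N.
Definition krylov_inv : table :=
  [:: [:: 1; 0; 2; 1; 2; 1; 2; 2; 0];
      [:: 2; 2; 2; 1; 1; 2; 0; 2; 1];
      [:: 1; 1; 2; 2; 1; 2; 2; 1; 1];
      [:: 0; 1; 0; 2; 1; 0; 1; 1; 1];
      [:: 1; 0; 2; 1; 2; 0; 0; 2; 1];
      [:: 2; 0; 0; 1; 2; 2; 1; 0; 1];
      [:: 1; 1; 2; 0; 2; 1; 0; 2; 1];
      [:: 2; 1; 0; 2; 2; 0; 2; 1; 1];
      [:: 2; 1; 0; 0; 0; 0; 0; 2; 0]]%N.

Definition D_table := ad_table r_row.
Definition f_row := trace_form_table (mul_table 9 9 9 D_table D_table).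
Definition h_row :=
  iter 3 (fun v => mul_table 1 9 9 v D_table) f_row.
Definition krylov_row j :=
  iter j (fun v => mul_table 1 9 9 v (ad_table y_row)) f_row.
Definition krylov_table : table :=
  tabulate 9 9 (fun j => entry (krylov_row j) 0).

(** The projection along [x] to the hyperplane of vectors with first coordinate
    0; both radicals have a generator whose first coordinate is 1. *)
Definition proj_table (x : table) : table :=
  tabulate 9 9 (fun i j => (i == j) + 2 * ((i == 0) * entry x 0 j))%N.

Lemma mx_proj x :
  mx 9 9 (proj_table x) = 1%:M - (delta_mx 0 0 : 'cV_9) *m mx 1 9 x.
Proof.
apply/matrixP=> i j; rewrite mx_tabulate !mxE big_ord1 !mxE eqxx andbT.
rewrite natrD !natrM; have -> : 2%:R = -1 :> 'F_3 by apply/eqP.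
by rewrite mulN1r.
Qed.

Lemma killing_computation :
  mul_table 9 9 9 killing_table killing_coker = proj_table r_row.
Proof. by vm_compute. Qed.
Lemma r_killing :
  mul_table 1 9 9 r_row killing_table = tabulate 1 9 (fun _ _ => 0%N).
Proof. by vm_compute. Qed.
Lemma form_computation :
  mul_table 9 9 9 (skewq_table h_row) form_coker = proj_table y_row.
Proof. by vm_compute. Qed.
Lemma y_form :
  mul_table 1 9 9 y_row (skewq_table h_row) = tabulate 1 9 (fun _ _ => 0%N).
Proof. by vm_compute. Qed.
Lemma f_y :
  (sum_upto 9 (fun i => entry f_row 0 i * entry y_row 0 i) %% 3 = 1)%N.
Proof. by vm_compute. Qed.
Lemma krylov_computation :
  mul_table 9 9 9 krylov_inv krylov_table = id_table.
Proof. by vm_compute. Qed.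

Lemma skewq_rigid (G : 'M['F_3]_9) : G \in unitmx ->
  (forall v, skewq (v *m G) = G^T *m skewq v *m G) -> G = 1%:M.
Proof.
pose r := mx 1 9 r_row; pose y := mx 1 9 y_row; pose D := ad skewq r.
have DE : mx 9 9 D_table = D by exact: mx_ad.
have Df : mx 1 9 f_row = trace_form skewq (D *m D).
  by rewrite mx_trace_form mx_mul DE.
have Dh : mx 1 9 h_row = trace_form skewq (D *m D) *m D *m D *m D.
  by rewrite /= 3!mx_mul Df DE.
have mx0 : mx 1 9 (tabulate 1 9 (fun _ _ => 0%N)) = 0.
  by apply/rowP=> j; rewrite mx_tabulate mxE.
apply: (@tensor_rigid 9 skewq r y); rewrite -/D -?Dh -?Df /r /y.
- by apply/eqP=> /rowP/(_ 0); rewrite !mxE.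
- by rewrite -mx_killing -mx_mul r_killing mx0.
- move=> x; rewrite -mx_killing.
  apply: (kernel_line (L := mx 9 9 killing_coker)).
  by rewrite -mx_mul killing_computation mx_proj.
- apply/eqP=> /matrixP/(_ 0 0); rewrite !mxE => fy0.
  have := natr_sum_upto 9 (fun i => entry f_row 0 i * entry y_row 0 i)%N.
  rewrite -natr_mod3 f_y.
  rewrite (eq_bigr (fun i => mx 1 9 f_row 0 i * (mx 1 9 y_row)^T i 0)).
    by rewrite fy0 => /eqP.
  by move=> i _; rewrite !mxE natrM.
- by rewrite -mx_skewq -mx_mul y_form mx0.
- move=> x; rewrite -mx_skewq.
  apply: (kernel_line (L := mx 9 9 form_coker)).
  by rewrite -mx_mul form_computation mx_proj.
apply/row_fullP; exists (mx 9 9 krylov_inv); rewrite -mx_id -krylov_computation.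
rewrite mx_mul; congr (_ *m _); apply/matrixP=> j k; rewrite mx_tabulate mxE.
rewrite (_ : _%:R = mx 1 9 (krylov_row j) 0 k); last by rewrite mxE.
congr (fun_of_matrix _ 0 k); rewrite -mx_ad.
by elim: (j : nat) => //= i ->; rewrite -mx_mul.
Qed.

Lemma lker_opp (F : fieldType) (U W : vectType F) (g : 'Hom(U, W)) :
  lker (- g) = lker g.
Proof. by apply/vspaceP=> v; rewrite !memv_ker opp_lfunE oppr_eq0. Qed.

Lemma lin1_mx_unit (F : fieldType) n (g : 'End('rV[F]_n)) :
  lker g == 0%VS -> lin1_mx g \in unitmx.
Proof.
move/lker0P=> g_inj; rewrite -row_free_unit; apply: inj_row_free => v.
by rewrite mul_rV_lin1 => gv; apply: g_inj; rewrite gv linear0.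
Qed.

Lemma Gamma_q : Gamma q =i pred1 \1%VF.
Proof.
move=> g; apply/andP/eqP=> [[ker_g /eqP qg]|->]; last first.
  rewrite ext2_map1 comp_lfun1l comp_lfun1r; split=> //.
  by apply/lker0P=> u v; rewrite !id_lfunE.
have G1 : lin1_mx g = 1%:M.
  apply: skewq_rigid (lin1_mx_unit ker_g) _ => v.
  rewrite mul_rV_lin1 -skew_ext2_map /= -[ext2_map g _]comp_lfunE -qg.
  by rewrite comp_lfunE.
by apply/lfunP=> v; rewrite -mul_rV_lin1 G1 mulmx1 id_lfunE.
Qed.

(** The similarities with factor -1 are the opposites of the isometries. *)
Lemma Gamma_sim_q g :
  (g \in Gamma_sim q) = (g \in Gamma q) || (- g \in Gamma q).
Proof.
have GammaN : (- g \in Gamma q) = (g \in @GL _ _) &&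
    ((q \o g)%VF == - (ext2_map g \o q)%VF).
  rewrite unfold_in /= ![_ \in @GL _ _]unfold_in lker_opp ext2_mapN.
  by rewrite comp_lfunNr eqr_oppLR.
rewrite GammaN -andb_orr [LHS]unfold_in; congr (_ && _).
apply/existsP/orP=> [[l /andP[l0 /eqP->]]|[] /eqP->].
- have /pred2P[->|->] : l \in pred2 1 (-1).
    by rewrite inE -sqrf_eq1 expr2 F3_sqr.
  + by left; rewrite scale1r.
  + by right; rewrite scaleN1r.
- by exists 1; rewrite scale1r eqxx.
- by exists (-1); rewrite scaleN1r eqxx.
Qed.

Theorem proposition4p5 :
  [/\ Gamma q =i pred1 \1%VF,
      Gamma_sim q =i pred2 \1%VF (- \1%VF)
    & forall g : 'End('rV['F_3]_9), g \in Gamma_sim q ->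
      forall L : {vspace 'rV['F_3]_9}, \dim L = 1%N -> (g @: L)%VS = L].
Proof.
have sim_q : Gamma_sim q =i pred2 \1%VF (- \1%VF).
  move=> g; rewrite Gamma_sim_q (Gamma_q g) (Gamma_q (- g)).
  by congr (_ || _); apply: eqr_oppLR.
split=> [|//|g]; first exact: Gamma_q.
rewrite sim_q => /pred2P[] -> L _; first exact: lim1g.
apply/vspaceP=> v; apply/memv_imgP/idP=> [[u Lu ->]|Lv].
  by rewrite opp_lfunE id_lfunE memvN.
by exists (- v); rewrite ?memvN // opp_lfunE id_lfunE opprK.
Qed.
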